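(* Let $\beta,\eta>0$ and $q>0$, and let $$F_{\beta,\eta}(s)=1-e^{-\beta(-\ln(1-s))^{\eta}},\qquad 0<s<1,$$ which is a distribution function on $(0,1)$. Let $M$ be a random variable with values in $[0,1]$ whose distribution is equivalent at $1$ to the distribution with distribution function $F_{\beta,\eta}$. Let $(R_n)$ be given by $R_n\stackrel{d}{=}q+M_nR_{n-1}$, $n\ge1$, where $M_n$ is a copy of $M$ independent of $R_{n-1}$, and let $R$ be the limit in distribution of $(R_n)$. Then $$\lim_{x\to\infty}\frac{\ln \mathbb{P}(R\ge x)}{x(\ln x)^{\eta}}=-\frac{\beta}{q}.$$
   Context: The initial variable $R_0$ is arbitrary. The limit $R$ (a perpetuity) satisfies $R\stackrel{d}{=}q+MR$ with $M$ independent of $R$ on the right-hand side, and $R\stackrel{d}{=}\sum_{j=1}^\infty q\prod_{k=1}^{j-1}M_k$ with $M_1,M_2,\dots$ i.i.d. copies of $M$. Equivalence at 1: for probability distributions $\mu,\nu$ on $[0,1]$ and $\delta\in(0,1)$ put $\mu_\delta=\mu((1-\delta,1])$ and $\nu_\delta=\nu((1-\delta,1])$. The distributions $\mu$ and $\nu$ are equivalent at $1$ if there exist $\varepsilon>0$ and $0<d<D<\infty$ such that $d\le \mu_\delta/\nu_\delta\le D$ for all $\delta\in(0,\varepsilon]$. *)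

(* Defs.v *)
From HB Require Import structures.
From mathcomp Require Import all_boot all_order all_algebra.
From mathcomp Require Import all_classical all_reals all_analysis.
From mathcomp Require Import measurable_realfun.

Set Implicit Arguments.
Unset Strict Implicit.
Unset Printing Implicit Defensive.

Import Order.TTheory GRing.Theory Num.Theory.
Import numFieldNormedType.Exports.

Local Open Scope classical_set_scope.
Local Open Scope ring_scope.

Definition F_beta_eta (R : realType) (beta eta s : R) : R :=
  1 - expR (- (beta * (- ln (1 - s)) `^ eta)).

(* The values on ]0, 1[ determine nu: they tend to 0 at 0 and to 1 at 1, so
   nu is carried by ]0, 1[. *)
Definition has_distribution_function_F (R : realType) (beta eta : R)
    (nu : probability R R) : Prop :=
  forall s : R, 0 < s < 1 -> nu `]-oo, s]%classic = (F_beta_eta beta eta s)%:E.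

(* If nu_delta = 0 the quotient below is 0, so the lower bound fails. *)
Definition equivalent_at_1 (R : realType)
    (mu nu : probability R R) : Prop :=
  exists eps d D : R, [/\ 0 < eps < 1, 0 < d, d < D &
    forall delta : R, 0 < delta <= eps ->
      d <= fine (mu `]1 - delta, 1]%classic)
           / fine (nu `]1 - delta, 1]%classic) <= D].

Definition same_law (R : realType) (d1 d2 : measure_display)
    (T1 : measurableType d1) (T2 : measurableType d2)
    (P1 : probability T1 R) (X1 : T1 -> R)
    (P2 : probability T2 R) (X2 : T2 -> R) : Prop :=
  forall A : set R, measurable A -> P1 (X1 @^-1` A) = P2 (X2 @^-1` A).

Definition independent_rv (R : realType) (d : measure_display)
    (T : measurableType d) (P : probability T R) (X Y : T -> R) : Prop :=
  forall A B : set R, measurable A -> measurable B ->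
    P (X @^-1` A `&` Y @^-1` B) = (P (X @^-1` A) * P (Y @^-1` B))%E.

Definition cvg_in_distribution (R : realType) (d d' : measure_display)
    (T : measurableType d) (P : probability T R) (X_ : nat -> {RV P >-> R})
    (T' : measurableType d') (P' : probability T' R) (X : {RV P' >-> R}) : Prop :=
  forall x : R, {for x, continuous (cdf X)} ->
    cdf (X_ n) x @[n --> \oo] --> cdf X x.

Section existence.
Context {R : realType} (beta eta : R).
Hypotheses (beta0 : 0 < beta) (eta0 : 0 < eta).

(* If T is standard exponential, quantile T has distribution function F. *)
Let quantile (t : R) : R := 1 - expR (- ((t / beta) `^ eta^-1)).

Let measurable_quantile : measurable_fun [set: R] quantile.
Proof.
apply: measurable_funB => //.
apply: (measurableT_comp (@measurable_expR R)).
apply: measurableT_comp => //.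
apply: (measurableT_comp (@measurable_powR R eta^-1)).
exact: measurable_funM.
Qed.

Let quantile_le (s t : R) : 0 < s < 1 -> 0 <= t ->
  (quantile t <= s) = (t <= beta * (- ln (1 - s)) `^ eta).
Proof.
move=> /andP[s0 s1] t0.
have ps : 0 < 1 - s by rewrite subr_gt0.
have L0 : 0 <= - ln (1 - s) by rewrite oppr_ge0 ln_le0// gerBl ltW.
rewrite /quantile lerBlDl -lerBlDr -[X in X <= _](lnK ps) ler_expR lerNr.
rewrite -[X in _ = (t <= X)]mulrC -ler_pdivrMr//.
have tb : 0 <= t / beta by rewrite divr_ge0// ltW.
apply/idP/idP => h.
  have -> : t / beta = ((t / beta) `^ eta^-1) `^ eta.
    by rewrite -powRrM mulVf ?gt_eqF// powRr1.
  by rewrite ge0_ler_powR ?nnegrE ?powR_ge0// ltW.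
have -> : - ln (1 - s) = ((- ln (1 - s)) `^ eta) `^ eta^-1.
  by rewrite -powRrM divff ?gt_eqF// powRr1.
by rewrite ge0_ler_powR ?nnegrE ?powR_ge0// invr_ge0 ltW.
Qed.

Let exp_neg : exponential_prob (1 : R) `]-oo, 0[%classic = 0%E.
Proof.
apply: integral0_eq => x; rewrite /= in_itv/= => x0.
by rewrite lt0_exponential_pdf.
Qed.

Lemma exists_has_distribution_function_F :
  exists nu : probability R R,
    has_distribution_function_F beta eta nu.
Proof.
have mq : measurable_fun [set: measurableTypeR R] (quantile : _ -> R).
  exact: measurable_quantile.
pose X : {mfun measurableTypeR R >-> R} := HB.pack (quantile : measurableTypeR R -> R)
  (isMeasurableFun.Build _ _ (measurableTypeR R) R quantile mq).
pose E : probability (measurableTypeR R) R :=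
  exponential_distribution_exponential_prob__canonical__probability_measure_Probability
    (@ltr01 R).
exists (distribution E X) => s s01.
have L0 : 0 < - ln (1 - s).
  by case/andP: s01 => s0 s1; rewrite oppr_gt0 ln_lt0// subr_gt0 s1 gtrBl.
set b := beta * (- ln (1 - s)) `^ eta.
have b0 : 0 < b by rewrite mulr_gt0 ?powR_gt0.
have mX : measurable (X @^-1` `]-oo, s]%classic : set R).
  by rewrite -[_ @^-1` _]setTI; exact: (measurable_quantile measurableT).
rewrite /distribution /pushforward /= -(setIT (X @^-1` _)).
have -> : [set: R] = `]-oo, 0[ `|` `[0, +oo[.
  by rewrite -setCitvr setvU.
rewrite setIUr measureU; [|exact: measurableI|exact: measurableI|]; last first.
  apply/seteqP; split => // x [[_ xn] [_ xp]].
  by move: xn xp; rewrite /= !in_itv/= andbT leNgt => ->.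
rewrite (_ : X @^-1` _ `&` `[0, +oo[ = `[0, b]%classic); last first.
  apply/seteqP; split => x /=; rewrite !in_itv/= andbT.
    by move=> [] xs x0; rewrite x0 -quantile_le.
  by move=> /andP[x0 xb]; rewrite x0; split => //; rewrite /X/= quantile_le.
rewrite [X in (_ + X)%E](exponential_prob_itv0c _ b0) mulN1r.
rewrite [X in (X + _)%E](_ : _ = 0%E) ?add0e//.
apply: (@subset_measure0 _ _ _ E _ `]-oo, 0[%classic) => //.
exact: measurableI.
Qed.
End existence.

(* Main.v *)
(** Write p_n(x) = P(R_n >= x), fix delta and put g = P(M > 1 - delta).

    Lower bound: k consecutive factors exceeding 1 - delta push a nonnegative
    R_n above k q (1 - k delta), so eventually
    p_n(k q (1 - k delta)) >= g^k / 2.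

    Upper bound: splitting on M <= 1 - delta gives, for x >= 2 q / delta,
    p_{n+1}(x) <= (1 - g) p_n(x + q) + g p_n(x - q).  If 4 g <= e^{-L} <= 1/4,
    this recursion halves the barrier H(x) = exp(-L (x - 2 q / delta) / q)
    and preserves additive constants.  So the influence of the arbitrary R_0 is
    forgotten geometrically fast and the limit has tail at most H.

    With delta = a / x, equivalence at 1 gives
    -ln g = beta (ln x)^eta (1 + o(1)), and both bounds become
    exp(-(1 + o(1)) (beta / q) x (ln x)^eta) once k ~ (1 + e) x / q (with a
    small) on one side, and 2 q / delta = e x on the other. *)

Require Import Defs.
From mathcomp Require Import all_boot all_order all_algebra.
From mathcomp Require Import all_classical all_reals all_analysis.
From mathcomp Require Import measurable_realfun lra ring.
Import Order.TTheory GRing.Theory Num.Theory.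
Import numFieldNormedType.Exports.

Local Open Scope classical_set_scope.
Local Open Scope ring_scope.

(** * Tails of a real random variable *)

Section tail.
Context {R : realType} {d : measure_display} {T : measurableType d}.
Variable P : probability T R.
Implicit Types (X : {RV P >-> R}) (x y : R).

(** Closed half-line, as in the event R >= x; [ccdf] uses the open one, so the two are interlaced
    below. *)
Definition tail X x : R := fine (P (X @^-1` `[x, +oo[%classic)).

Lemma measurable_preim X (A : set R) : measurable A -> measurable (X @^-1` A).
Proof. by move=> mA; rewrite -[_ @^-1` _]setTI; exact: measurable_funP. Qed.

Lemma tailE X x : (tail X x)%:E = P (X @^-1` `[x, +oo[%classic).
Proof. by rewrite /tail fineK// fin_num_measure//; exact: measurable_preim. Qed.

Lemma tail_ge0 X x : 0 <= tail X x.
Proof. by rewrite -lee_fin tailE. Qed.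

Lemma tail_le1 X x : tail X x <= 1.
Proof. by rewrite -lee_fin tailE probability_le1//; exact: measurable_preim. Qed.

Lemma tail_anti X x y : x <= y -> tail X y <= tail X x.
Proof.
move=> xy; rewrite -lee_fin !tailE le_measure ?inE//; [exact: measurable_preim..|].
by apply: preimage_subset; apply: subset_itvr; rewrite bnd_simp.
Qed.

Lemma ccdf_le_tail X x : (ccdf X x <= (tail X x)%:E)%E.
Proof.
rewrite tailE /ccdf /distribution /pushforward.
rewrite le_measure ?inE//; [exact: measurable_preim..|].
by apply: preimage_subset; apply: subset_itvr; rewrite bnd_simp.
Qed.

Lemma tail_le_ccdf X x y : x < y -> ((tail X y)%:E <= ccdf X x)%E.
Proof.
move=> xy; rewrite tailE /ccdf /distribution /pushforward.
rewrite le_measure ?inE//; [exact: measurable_preim..|].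
by apply: preimage_subset; apply: subset_itvr; rewrite bnd_simp.
Qed.

Lemma tail_small X (t : R) : 0 < t -> exists x, forall y, x <= y -> tail X y <= t.
Proof.
move=> t0; have /fine_cvgP[_ /cvgrPdist_le/(_ _ t0)] := cvg_ccdfy0 X.
move=> [A [_ hA]]; exists (A + 2) => y Ay.
have := hA (A + 1); rewrite ltrDl ltr01 => /(_ isT) /=.
rewrite sub0r normrN ger0_norm; last by rewrite fine_ge0.
apply: le_trans; rewrite -lee_fin [leRHS]fineK ?fin_num_measure//.
apply: tail_le_ccdf; by rewrite (lt_le_trans _ Ay)// ltrD2l; lra.
Qed.

Lemma tail_large X (t : R) : t < 1 -> exists x, forall y, y <= x -> t <= tail X y.
Proof.
move=> t1; have t0 : 0 < 1 - t by rewrite subr_gt0.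
have /fine_cvgP[_ /cvgrPdist_le/(_ _ t0)] := cvg_ccdfNy1 X.
move=> [A [_ hA]]; exists (A - 1) => y Ay.
have := hA (A - 1); rewrite ltrBlDr ltrDl ltr01 => /(_ isT) /=.
move=> /(le_trans (ler_norm _)).
rewrite lerD2l lerN2 => /le_trans; apply; apply: le_trans (tail_anti X _ _ Ay).
by rewrite -lee_fin [leLHS]fineK ?fin_num_measure//; exact: ccdf_le_tail.
Qed.

End tail.

(** * One step of the recursion, for [Y] distributed as q + M1 X *)

Section perpetuity_step.
Context {R : realType} {dM d : measure_display}.
Context {TM : measurableType dM} {PM : probability TM R} {M : {RV PM >-> R}}.
Context {T : measurableType d} {P : probability T R} {X M1 Y : {RV P >-> R}}.
Variable q : R.
Hypothesis q_gt0 : 0 < q.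
Hypothesis M_01 : forall w, 0 <= M w <= 1.
Hypothesis M1_copy : same_law P M1 PM M.
Hypothesis M1_indep : independent_rv P M1 X.
Hypothesis Y_law : same_law P Y P (fun w => q + M1 w * X w).

(** The pointwise bounds on [M] reach its copy [M1] only through the law, so only up to a null
    event. *)
Let P_M1_out : P (M1 @^-1` (~` `[0, 1]%classic)) = 0%E.
Proof.
rewrite M1_copy; last exact: measurableC.
rewrite (_ : _ @^-1` _ = set0) ?measure0//.
by apply/seteqP; split => // w /=; rewrite in_itv/= M_01.
Qed.

Let tail_Y x : (tail P Y x)%:E = P [set w | x <= q + M1 w * X w].
Proof.
rewrite tailE Y_law//; congr (P _).
by apply/seteqP; split => w /=; rewrite in_itv/= andbT.
Qed.

Let measurable_Y x : measurable [set w | x <= q + M1 w * X w].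
Proof.
rewrite (_ : [set _ | _] = (fun w => q + M1 w * X w) @^-1` `[x, +oo[%classic).
  rewrite -[_ @^-1` _]setTI.
  have : measurable_fun setT (fun w => q + M1 w * X w).
    by apply: measurable_funD => //; exact: measurable_funM.
  exact.
by apply/seteqP; split => w /=; rewrite in_itv/= andbT.
Qed.

(** Off a null event, q + M1 X >= x > q forces X > 0. Then either M1 <= 1 - delta and X >= y, or M1
    > 1 - delta and X >= x - q; independence turns these two events into the two products. *)
Lemma tail_step_le (delta x y : R)
    (g := fine (distribution PM M `]1 - delta, 1]%classic)) :
  0 < delta < 1 -> q < x -> (1 - delta) * y <= x - q ->
  tail P Y x <= (1 - g) * tail P X y + g * tail P X (x - q).
Proof.
move=> /andP[d0 d1] qx yx.
set A := `[0, 1 - delta]%classic : set R.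
set B := `]1 - delta, 1]%classic : set R.
have gE : g%:E = P (M1 @^-1` B).
  by rewrite /g fineK ?fin_num_measure// (M1_copy _ (measurable_itv _)).
have mX z : measurable (X @^-1` `[z, +oo[%classic) by exact: measurable_preim.
have mA : measurable (M1 @^-1` A) by apply: measurable_preim; exact: measurable_itv.
have mB : measurable (M1 @^-1` B) by apply: measurable_preim; exact: measurable_itv.
have hA : (P (M1 @^-1` A) <= (1 - g)%:E)%E.
  rewrite EFinB gE leeBrDr ?fin_num_measure//.
  rewrite -measureU//; first by rewrite probability_le1//; exact: measurableU.
  apply/seteqP; split => // w.
  rewrite /A /B /= !in_itv/= => -[/andP[_ h1] /andP[h2 _]].
  by move: (le_lt_trans h1 h2); rewrite ltxx.
have mAB : measurable (M1 @^-1` A `&` X @^-1` `[y, +oo[ `|`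
    M1 @^-1` B `&` X @^-1` `[x - q, +oo[).
  by apply: measurableU; exact: measurableI.
have mC : measurable (M1 @^-1` (~` `[0, 1]%classic)).
  by apply: measurable_preim; exact: measurableC.
rewrite -lee_fin EFinD !EFinM tail_Y !tailE.
apply: (@le_trans _ _ (P ((M1 @^-1` A `&` X @^-1` `[y, +oo[ `|`
    M1 @^-1` B `&` X @^-1` `[x - q, +oo[) `|` M1 @^-1` (~` `[0, 1]%classic)))).
  rewrite le_measure ?inE//; first exact: measurableU.
  move=> w /= hx; have [M01|] := boolP (M1 w \in `[0, 1]); last first.
    by move=> /negP; right.
  left; move: M01; rewrite in_itv/= => /andP[M0 M1'].
  have MX : x - q <= M1 w * X w by rewrite lerBlDl.
  have X0 : 0 < X w.
    rewrite ltNge; apply/negP => X0.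
    by have := mulr_ge0_le0 M0 X0; nra.
  have [MD|MD] := leP (M1 w) (1 - delta).
    left; rewrite /A /= !in_itv/= M0 MD andbT; split => //.
    rewrite andbT -(@ler_pM2l _ (1 - delta)) ?subr_gt0//.
    by apply: (le_trans yx); apply: (le_trans MX); rewrite ler_pM2r.
  right; rewrite /B /= !in_itv/= MD M1' !andbT; split => //.
  by apply: (le_trans MX); rewrite ler_piMl// ltW.
apply: (le_trans (measureU2 _ _ _)) => //.
rewrite [X in (_ + X)%E](_ : _ = 0%E) ?adde0; last exact: P_M1_out.
apply: (le_trans (measureU2 _ _ _)); [exact: measurableI..|].
apply: leeD.
  apply: (@le_trans _ _ (P (M1 @^-1` A) * P (X @^-1` `[y, +oo[%classic))%E).
    by rewrite -M1_indep//; exact: measurable_itv.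
  exact: lee_wpmul2r.
by rewrite gE -M1_indep//; exact: measurable_itv.
Qed.

Lemma tail_step_ge (delta s : R)
    (g := fine (distribution PM M `]1 - delta, 1]%classic)) :
  delta <= 1 -> 0 <= s -> g * tail P X s <= tail P Y (q + (1 - delta) * s).
Proof.
move=> d1 s0.
set B := `]1 - delta, 1]%classic : set R.
have gE : g%:E = P (M1 @^-1` B).
  by rewrite /g fineK ?fin_num_measure// (M1_copy _ (measurable_itv _)).
rewrite -lee_fin EFinM tail_Y tailE gE -M1_indep; [|exact: measurable_itv..].
rewrite le_measure ?inE//.
  by apply: measurableI; apply: measurable_preim; exact: measurable_itv.
move=> w [] /=; rewrite /B /= !in_itv/= andbT => /andP[h1 h2] h3.
rewrite lerD2l; apply: (@le_trans _ _ (M1 w * s)).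
  by rewrite ler_wpM2r// ltW.
by rewrite ler_wpM2l// (le_trans _ (ltW h1))// subr_ge0.
Qed.

(** A factor in [0, 1] cannot lower a negative X, so X >= -(y + q) gives q + M1 X >= -y; for X >= 0
    the sum is even nonnegative. *)
Lemma tail_step_neg (y : R) : 0 <= y -> tail P X (- (y + q)) <= tail P Y (- y).
Proof.
move=> y0.
have mX : measurable (X @^-1` `[- (y + q), +oo[%classic) by exact: measurable_preim.
have mC : measurable (M1 @^-1` (~` `[0, 1]%classic)).
  by apply: measurable_preim; exact: measurableC.
rewrite -lee_fin tail_Y tailE.
apply: (@le_trans _ _ (P ([set w | - y <= q + M1 w * X w] `|`
    M1 @^-1` (~` `[0, 1]%classic)))).
  rewrite le_measure ?inE//; first exact: measurableU.
  move=> w /=; rewrite in_itv/= andbT => hx.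
  have [|/negP] := boolP (M1 w \in `[0, 1]); last by right.
  rewrite in_itv/= => /andP[M0 M1']; left => /=.
  have [X0|X0] := leP 0 (X w).
    by rewrite (@le_trans _ _ 0) ?oppr_le0// addr_ge0 ?mulr_ge0// ltW.
  have : X w <= M1 w * X w by rewrite -[leLHS]mul1r ler_wnM2r// ltW.
  by move: (M1 w * X w) => MX; lra.
apply: (le_trans (measureU2 _ _ _)) => //.
by rewrite [X in (_ + X)%E](_ : _ = 0%E) ?adde0//; exact: P_M1_out.
Qed.

End perpetuity_step.

(** * Iterated bounds on the tails of [R_] *)

Section perpetuity.
Context {R : realType} {dM d : measure_display}.
Context {TM : measurableType dM} {PM : probability TM R} {M : {RV PM >-> R}}.
Context {T : measurableType d} {P : probability T R} {R_ M_ : nat -> {RV P >-> R}}.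
Variable q : R.
Hypothesis q_gt0 : 0 < q.
Hypothesis M_01 : forall w, 0 <= M w <= 1.
Hypothesis M_copy : forall n, same_law P (M_ n.+1) PM M.
Hypothesis M_indep : forall n, independent_rv P (M_ n.+1) (R_ n).
Hypothesis R_rec : forall n,
  same_law P (R_ n.+1) P (fun w => q + M_ n.+1 w * R_ n w).

Let tail_neg n y : 0 <= y ->
  tail P (R_ 0) (- (y + n%:R * q)) <= tail P (R_ n) (- y).
Proof.
elim: n y => [|n IH] y y0; first by rewrite mul0r addr0.
apply: le_trans (tail_step_neg _ q_gt0 M_01 (M_copy n) (R_rec n) _ y0).
have -> : y + n.+1%:R * q = (y + q) + n%:R * q by rewrite -natr1; ring.
by apply: IH; rewrite addr_ge0// ltW.
Qed.

(* Since M <= 1, R_n < -y forces R_0 < -(y + n q). *)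
Lemma tail_nonneg : exists N, forall n, (N <= n)%N -> 2^-1 <= tail P (R_ n) 0.
Proof.
have [x hx] : exists x, forall y, y <= x -> 2^-1 <= tail P (R_ 0) y.
  by apply: tail_large; lra.
exists (Num.truncn (- x / q)).+1 => n hn.
rewrite -oppr0; apply: le_trans (tail_neg n _ (lexx _)).
apply: hx; rewrite add0r lerNl -ler_pdivrMr//.
apply: ltW; apply: (lt_le_trans (truncnS_gt _)).
by rewrite ler_nat.
Qed.

(** Induction on k: each further factor exceeding 1 - delta costs a factor g, and the base case 1/2
    is [tail_nonneg]. The rank N grows with k, as one more step of the recursion is used. *)
Lemma tail_lower_bound (delta : R) (k : nat)
    (g := fine (distribution PM M `]1 - delta, 1]%classic)) :
  0 <= delta -> k%:R * delta <= 1 ->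
  exists N, forall n, (N <= n)%N ->
    g ^+ k / 2 <= tail P (R_ n) (k%:R * q * (1 - k%:R * delta)).
Proof.
move=> d0; have [N0 hN0] := tail_nonneg.
have g0 : 0 <= g by rewrite fine_ge0.
elim: k => [|k IH] kd.
  by exists N0 => n /hN0; rewrite expr0 !mul0r div1r.
have kd1 : k%:R * delta <= 1.
  by apply: le_trans kd; rewrite ler_wpM2r// ler_nat.
have [N hN] := IH kd1.
exists N.+1 => -[//|n] nN.
set s := k%:R * q * (1 - k%:R * delta).
have s0 : 0 <= s by rewrite !mulr_ge0 ?subr_ge0// ltW.
have d1 : delta <= 1.
  by apply: le_trans kd; rewrite ler_peMl// ler1n.
apply: (@le_trans _ _ (g * tail P (R_ n) s)).
  by rewrite exprS -mulrA ler_wpM2l// hN.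
apply: (le_trans (tail_step_ge _ (M_copy n) (M_indep n) (R_rec n) _ _ d1 s0)).
apply: tail_anti; rewrite /s -natr1.
rewrite -subr_ge0.
(* The next level lies below q + (1 - delta) s: the gap is a sum of nonnegative terms. *)
rewrite (_ : _ - _ = q * delta * (k%:R + 1 + k%:R * k%:R * delta)); last by ring.
by rewrite !mulr_ge0 ?addr_ge0 ?mulr_ge0// ltW.
Qed.

(** The tail of R_n stays below tau + C_n H with C_n = max(1, C / 2^n), so C_n = 1 for large n. *)
Lemma tail_upper_bound (delta L tau x : R) :
  0 < delta < 1 ->
  fine (distribution PM M `]1 - delta, 1]%classic) <= expR (- L) / 4 ->
  expR (- L) <= 4^-1 -> 0 < tau ->
  exists N, forall n, (N <= n)%N ->
    tail P (R_ n) x <= tau + expR (- (L * ((x - 2 * q / delta) / q))).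
Proof.
set g := fine _ => /andP[d0 d1] gL L4 tau0.
pose H x := expR (- (L * ((x - 2 * q / delta) / q))).
have g0 : 0 <= g by rewrite fine_ge0.
have L0 : 0 <= L.
  rewrite -oppr_le0 -expR_le1; apply: (le_trans L4); lra.
have H0 y : 0 < H y by exact: expR_gt0.
have Hp y : H (y + q) = expR (- L) * H y.
  rewrite /H -expRD; congr expR; field.
  by rewrite !gt_eqF.
have Hm y : H y = expR (- L) * H (y - q) by rewrite -Hp subrK.
have Hanti y z : y <= z -> H z <= H y.
  move=> yz; rewrite ler_expR lerN2 ler_wpM2l// ler_pM2r ?invr_gt0//.
  by rewrite lerD2r.
have H1 y : y <= 2 * q / delta -> 1 <= H y.
  move=> h; rewrite -expR0 ler_expR oppr_ge0 mulr_ge0_le0//.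
  by rewrite pmulr_lle0 ?invr_gt0// subr_le0.
(* Below the threshold 2 q / delta only tail <= 1 <= H is available, hence the maximum with 1. *)
have step n C : 0 <= C -> (forall y, tail P (R_ n) y <= tau + C * H y) ->
    forall y, tail P (R_ n.+1) y <= tau + Num.max 1 (C / 2) * H y.
  move=> C0 hn y.
  have [yx|xy] := leP y (2 * q / delta).
    apply: (le_trans (tail_le1 _ _ _)); apply: (le_trans (H1 _ yx)).
    apply: (@le_trans _ _ (Num.max 1 (C / 2) * H y)).
      by rewrite ler_peMl ?(ltW (H0 _))// le_max lexx.
    by rewrite lerDr ltW.
  have qy : 2 * q < y * delta by rewrite -ltr_pdivrMr.
  have y0 : 0 < y by rewrite (lt_trans _ xy)// !mulr_gt0 ?invr_gt0.
  have qy' : 2 * q < y by apply: (lt_trans qy); rewrite gtr_pMr.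
  (* With y + q as the upper level, the condition (1 - delta)(y + q) <= y - q reads 2 q <= delta (y
     + q), which holds above the threshold. *)
  apply: (le_trans (tail_step_le _ M_01 (M_copy n) (M_indep n) (R_rec n)
    delta y (y + q) _ _ _)).
  - by rewrite d0.
  - lra.
  - have : 0 < delta * q by rewrite mulr_gt0.
    nra.
  rewrite -/g.
  have g1 : g <= 1 by apply: (le_trans gL); lra.
  apply: (@le_trans _ _ ((1 - g) * (tau + C * H (y + q)) +
      g * (tau + C * H (y - q)))).
    by rewrite lerD// ler_wpM2l// subr_ge0.
  have -> : (1 - g) * (tau + C * H (y + q)) + g * (tau + C * H (y - q)) =
      tau + C * ((1 - g) * H (y + q) + g * H (y - q)) by ring.
  rewrite lerD2l; apply: (@le_trans _ _ (C / 2 * H y)).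
    rewrite -mulrA ler_wpM2l// Hp.
    (* Each term contributes at most H y / 4: the first by e^{-L} <= 1/4, the second because g <=
       e^{-L} / 4 offsets H (y - q) = e^L H y. *)
    have h1 : (1 - g) * (expR (- L) * H y) <= H y / 4.
      apply: (@le_trans _ _ (expR (- L) * H y)).
        by rewrite ler_piMl ?mulr_ge0 ?expR_ge0// gerBl.
      by rewrite mulrC ler_wpM2l// expR_ge0.
    have h2 : g * H (y - q) <= H y / 4.
      by rewrite (Hm y) mulrAC ler_wpM2r// expR_ge0.
    lra.
  by rewrite ler_wpM2r ?(ltW (H0 _))// le_max lexx orbT.
(* [tau] absorbs the tail of R_0 beyond K, and C * H exceeds 1 below K. *)
have [K hK] := tail_small P (R_ 0) _ tau0.
pose C := (H K)^-1.
have C0 : 0 < C by rewrite invr_gt0.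
have all_n n y : tail P (R_ n) y <= tau + Num.max 1 (C / 2 ^+ n) * H y.
  elim: n y => [|n IH] y.
    have [Ky|yK] := leP K y.
      apply: (le_trans (hK _ Ky)); rewrite lerDl mulr_ge0//.
        by rewrite le_max ler01.
      exact/ltW.
    apply: (le_trans (tail_le1 _ _ _)).
    apply: (@le_trans _ _ (C * H y)).
      by rewrite -ler_pdivrMl// invrK mulr1 Hanti// ltW.
    rewrite expr0 divr1 (@le_trans _ _ (Num.max 1 C * H y))//.
      by rewrite ler_wpM2r ?(ltW (H0 _))// le_max lexx orbT.
    by rewrite lerDr ltW.
  have m0 : 0 <= Num.max 1 (C / 2 ^+ n) by rewrite le_max ler01.
  apply: (le_trans (step n _ m0 IH y)); rewrite lerD2l ler_wpM2r ?(ltW (H0 _))//.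
  rewrite ge_max le_max lexx /= le_max.
  case: (leP 1 (C / 2 ^+ n)) => h.
    by rewrite exprSr invfM mulrA lexx orbT.
  by apply/orP; left; lra.
(* For n >= N, C < N <= n <= 2^n, so the maximum with 1 equals 1. *)
pose N := (Num.truncn C).+1.
exists N => n nN; apply: (le_trans (all_n n x)).
rewrite (max_l (_ : C / 2 ^+ n <= 1)) ?mul1r//.
rewrite ler_pdivrMr ?exprn_gt0// mul1r; apply: ltW.
apply: (lt_le_trans (truncnS_gt _)); apply: (@le_trans _ _ n%:R).
  by rewrite ler_nat.
by rewrite -natrX ler_nat ltnW// ltn_expl.
Qed.

End perpetuity.

(** * Passage to the limit in distribution *)

Lemma cdf_continuity_point {R : realType} {d : measure_display}
    {T : measurableType d} {P : probability T R} (X : {RV P >-> R}) (a b : R) :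
  a < b -> exists2 c, a < c < b & {for c, continuous (cdf X)}.
Proof.
move=> ab; pose F r := fine (cdf X r).
have cdfE : cdf X = EFin \o F.
  by apply/funext => r; rewrite /F /= fineK// fin_num_measure.
have ndF : nondecreasing_fun F.
  by move=> r s rs; rewrite /F fine_le ?fin_num_measure// cdf_nondecreasing.
pose D := [set x | x \in (`]a, b[) /\ discontinuity F x].
have cD : countable D by apply: discontinuity_countable => r s _ _; exact: ndF.
(* A monotone function has countably many discontinuities, which cannot fill an interval of positive
   Lebesgue measure. *)
have [c cab ncD] : exists2 c : R, a < c < b & ~ D c.
  apply: contrapT => h.
  have abD : `]a, b[%classic `<=` D.
    move=> c cab; apply: contrapT => nD; apply: h; exists c => //.
  have := countable_lebesgue_measure0 (sub_countable (subset_card_le abD) cD).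
  rewrite lebesgue_measure_itv/= lte_fin ab => /(congr1 fine)/=; lra.
exists c => //.
have Fr : F x @[x --> c^'+] --> F c.
  by have := @cdf_right_continuous _ _ _ _ X c; rewrite cdfE => /fine_cvg.
have Fl : cvg (F x @[x --> c^'-]).
  apply: nondecreasing_at_left_is_cvgr.
    by near=> x => r s _ _; exact: ndF.
  by near=> x; exists (F c) => _ /= [s /[!in_itv]/= /andP[_ /ltW sc] <-];
    exact: ndF.
(* By right continuity the right limit is F c, so a different left limit would put c in [D]. *)
have lE : lim (F x @[x --> c^'-]) = F c.
  apply: contra_notP ncD => ne; split; first by rewrite in_itv.
  split => //; first exact: cvgP Fr.
  have -> : lim (F x @[x --> c^'+]) = F c by exact: cvg_lim Fr.
  exact/eqP.
rewrite cdfE; apply: cvg_EFin; first exact: nearW.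
apply/left_right_continuousP; split; last exact: Fr.
by change (F x @[x --> c^'-] --> F c); rewrite -lE; exact: Fl.
Unshelve. all: end_near. Qed.

Section convergence_in_distribution.
Context {R : realType} {d d' : measure_display}.
Context {T : measurableType d} {P : probability T R} {X_ : nat -> {RV P >-> R}}.
Context {T' : measurableType d'} {P' : probability T' R} {X : {RV P' >-> R}}.
Hypothesis X_cvg : cvg_in_distribution X_ X.

Lemma cvg_ccdf x : {for x, continuous (cdf X)} ->
  ccdf (X_ n) x @[n --> \oo] --> ccdf X x.
Proof.
move=> cx; rewrite ccdf_1_cdf (_ : (fun n => _) = (fun n => 1%:E - cdf (X_ n) x)%E).
  by apply: cvgeB; [rewrite fin_num_adde_defr|exact: cvg_cst|exact: X_cvg].
by apply/funext => n; rewrite ccdf_1_cdf.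
Qed.

(** The strict gap leaves room for a continuity point c of the limit law, where [ccdf] converges;
    monotonicity moves from x to c and from c to y. *)
Lemma cvg_in_distribution_tail_le (x y b : R) : x < y ->
  (exists N, forall n, (N <= n)%N -> tail P (X_ n) x <= b) -> tail P' X y <= b.
Proof.
move=> xy [N hN]; have [c /andP[xc cy] cc] := cdf_continuity_point X _ _ xy.
rewrite -lee_fin; apply: (le_trans (tail_le_ccdf _ X _ _ cy)).
apply: cvge_le (cvg_ccdf _ cc); exists N => // n /= Nn.
apply: (le_trans (ccdf_le_tail _ _ _)); rewrite lee_fin.
by apply: le_trans (hN _ Nn); apply: tail_anti; exact: ltW.
Qed.

Lemma cvg_in_distribution_tail_ge (x y b : R) : x < y ->
  (exists N, forall n, (N <= n)%N -> b <= tail P (X_ n) y) -> b <= tail P' X x.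
Proof.
move=> xy [N hN]; have [c /andP[xc cy] cc] := cdf_continuity_point X _ _ xy.
rewrite -lee_fin; apply: (@le_trans _ _ (ccdf X c)); last first.
  apply: (le_trans (ccdf_le_tail _ _ _)); rewrite lee_fin.
  by apply: tail_anti; exact: ltW.
apply: cvge_ge (cvg_ccdf _ cc); exists N => // n /= Nn.
by apply: le_trans (tail_le_ccdf _ _ _ _ cy); rewrite lee_fin hN.
Qed.

End convergence_in_distribution.

(** * Mass near 1 *)

Section distribution_function_F.
Context {R : realType} {beta eta : R} {nu : probability R R}.
Hypotheses (beta_gt0 : 0 < beta) (eta_gt0 : 0 < eta).
Hypothesis nu_F : has_distribution_function_F beta eta nu.

(** [nu_F] speaks only of points of ]0, 1[. If v = nu(]-oo, 1]) were below 1, the point s with 1 -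
    F(s) = (1 - v) / 2 would give F(s) > v, against F(s) = nu(]-oo, s]) <= v. *)
Let nu_le1 : nu `]-oo, 1]%classic = 1%E.
Proof.
apply/eqP; rewrite eq_le probability_le1//=.
rewrite -(fineK (fin_num_measure nu _ (measurable_itv `]-oo, (1:R)]))) lee_fin.
set v := fine _; rewrite leNgt; apply/negP => v1.
have v0 : 0 <= v by rewrite fine_ge0.
pose tau := (1 - v) / 2.
have tau0 : 0 < tau by rewrite divr_gt0 ?subr_gt0.
have tau1 : tau < 1 by rewrite /tau; lra.
have L0 : 0 < - ln tau / beta by rewrite divr_gt0// oppr_gt0 ln_lt0// tau0.
(* Solves beta t^eta = - ln tau, so that 1 - F(s) = tau at s = 1 - e^{-t}. *)
pose t := (- ln tau / beta) `^ eta^-1.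
have t0 : 0 < t by exact: powR_gt0.
pose s := 1 - expR (- t).
have s01 : 0 < s < 1.
  by rewrite /s subr_gt0 expR_lt1 oppr_lt0 t0 gtrBl expR_gt0.
have sv : F_beta_eta beta eta s <= v.
  rewrite -lee_fin -(nu_F _ s01) /v fineK ?fin_num_measure//.
  rewrite le_measure ?inE//.
  by apply: subset_itvl; rewrite bnd_simp; case/andP: s01 => _ /ltW.
move: sv; rewrite /F_beta_eta /s subKr expRK opprK /t -powRrM mulVf ?gt_eqF//.
rewrite powRr1 ?(ltW L0)// mulrCA divff ?gt_eqF// mulr1 opprK lnK ?posrE//.
by rewrite /tau; lra.
Qed.

Lemma measure_near_1 (delta : R) : 0 < delta < 1 ->
  fine (nu `]1 - delta, 1]%classic) = expR (- (beta * (- ln delta) `^ eta)).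
Proof.
move=> /andP[d0 d1].
have := nu_le1.
rewrite (_ : `]-oo, 1]%classic =
  `]-oo, 1 - delta]%classic `|` `]1 - delta, 1]%classic); last first.
  by rewrite -itv_bndbnd_setU// bnd_simp gerBl ltW.
rewrite measureU//=; last first.
  apply/seteqP; split => // x [] /=; rewrite !in_itv/= => h1 /andP[h2 _].
  by move: (le_lt_trans h1 h2); rewrite ltxx.
rewrite nu_F ?subr_gt0 ?d1 ?gtrBl// /F_beta_eta subKr.
move=> /(congr1 fine); rewrite fineD ?fin_num_measure//=; lra.
Qed.

Lemma equivalent_at_1_bounds {mu : probability R R} : equivalent_at_1 mu nu ->
  exists eps c C, [/\ 0 < eps < 1, 0 < c, 0 < C & forall delta, 0 < delta <= eps ->
    c * expR (- (beta * (- ln delta) `^ eta)) <= fine (mu `]1 - delta, 1]%classic)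
    <= C * expR (- (beta * (- ln delta) `^ eta))].
Proof.
move=> [eps [c [C [e01 c0 cC h]]]]; exists eps, c, C; split => //.
  exact: lt_trans cC.
move=> delta /andP[d0 de]; have := h delta; rewrite d0 de => /(_ isT).
have d1 : delta < 1 by apply: (le_lt_trans de); case/andP: e01.
rewrite measure_near_1 ?d0//.
by rewrite ler_pdivlMr ?ler_pdivrMr ?expR_gt0.
Qed.

End distribution_function_F.

(** * Asymptotics of powers of the logarithm *)

Section log_asymptotics.
Context {R : realType}.
Implicit Types a b eta : R.

Lemma cvgy_ln : ln x @[x --> +oo%R] --> (+oo%R : set_system R).
Proof.
apply/cvgryPge => A; near=> x.
rewrite -(expRK A) ler_ln ?posrE ?expR_gt0//.
Unshelve. all: end_near. Qed.

Lemma cvgy_powR_ln eta : 0 < eta ->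
  ln x `^ eta @[x --> +oo%R] --> (+oo%R : set_system R).
Proof.
move=> eta0; apply/cvgryPge => A.
have /cvgryPge/(_ (`|A| `^ eta^-1)) := cvgy_ln.
apply: filterS => x hx; apply: (le_trans (ler_norm A)).
rewrite -[leLHS]powRr1// -(mulVf (lt0r_neq0 eta0)) powRrM.
rewrite ge0_ler_powR ?nnegrE ?powR_ge0 ?(ltW eta0)//.
exact: le_trans (powR_ge0 _ _) hx.
Qed.

Lemma near_powR_ln_div_ge A a eta : 0 < a -> 0 < eta ->
  \forall x \near +oo%R, A <= ln (x / a) `^ eta.
Proof.
move=> a0 eta0.
have xa : x / a @[x --> +oo%R] --> (+oo%R : set_system R).
  by apply: gt0_cvgMly; rewrite ?invr_gt0//; exact: cvg_id.
have : ln (x / a) `^ eta @[x --> +oo%R] --> (+oo%R : set_system R).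
  apply: (@cvg_comp _ _ _ (fun x => x / a) (fun x => ln x `^ eta) _ _ _ xa).
  exact: cvgy_powR_ln.
by move/cvgryPge; exact.
Qed.

(** ln (x / a) / ln x = 1 - ln a / ln x tends to 1, and w^eta is continuous at 1. For x > max(1, a)
    both logarithms are nonnegative, so the power splits over the product. *)
Lemma cvgy_powR_ln_ratio a eta : 0 < a ->
  ln (x / a) `^ eta / ln x `^ eta @[x --> +oo%R] --> (1 : R).
Proof.
move=> a0.
have lnV : (ln x)^-1 @[x --> +oo%R] --> (0 : R).
  apply/gtr0_cvgV0; last exact: cvgy_ln.
  by near=> x; apply: ln_gt0; near: x;
    apply: nbhs_pinfty_gt; exact: num_real.
have cu : 1 - ln a * (ln x)^-1 @[x --> +oo%R] --> (1 : R).
  rewrite -[X in _ --> X]subr0 -[X in _ --> _ - X](mulr0 (ln a)).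
  by apply: cvgB; [exact: cvg_cst|apply: cvgM => //; exact: cvg_cst].
have cw : (1 - ln a * (ln x)^-1) `^ eta @[x --> +oo%R] --> (1 `^ eta : R).
  have c1 : {for (1 : R), continuous (fun w : R => w `^ eta)}.
    apply: differentiable_continuous; apply/derivable1_diffP.
    by apply: ex_derive; exact: is_derive1_powR.
  exact: (continuous_cvg _ c1 cu).
rewrite powR1 in cw.
apply: cvg_trans cw; apply: near_eq_cvg; near=> x.
have x1 : 1 < x by near: x; apply: nbhs_pinfty_gt; exact: num_real.
have x0 : 0 < x by rewrite (lt_trans _ x1).
have ax : a < x by near: x; apply: nbhs_pinfty_gt; exact: num_real.
have lx : 0 < ln x by exact: ln_gt0.
have la : 0 <= ln (x / a) by rewrite ln_ge0// ler_pdivlMr// mul1r ltW.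
have -> : 1 - ln a * (ln x)^-1 = ln (x / a) / ln x.
  by rewrite ln_div ?posrE// mulrBl divff ?gt_eqF.
rewrite -[in RHS](divfK (lt0r_neq0 lx) (ln (x / a))).
rewrite [in RHS]powRM ?divr_ge0 ?(ltW lx)//.
by rewrite mulfK// gt_eqF// powR_gt0.
Unshelve. all: end_near. Qed.

(** Common shape of the lower and upper bounds on ln P(R >= x) below: after division only the term
    in b survives, c0 and c1 being of lower order. *)
Lemma cvgy_affine_powR_ln c0 c1 C a b eta : 0 < a -> 0 < eta ->
  (c0 + x * C * (c1 - b * ln (x / a) `^ eta)) / (x * ln x `^ eta) @[x --> +oo%R]
    --> (- (C * b) : R).
Proof.
move=> a0 eta0.
have lV : (ln x `^ eta)^-1 @[x --> +oo%R] --> (0 : R).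
  apply/gtr0_cvgV0; last exact: cvgy_powR_ln.
  by near=> x; apply: powR_gt0; apply: ln_gt0; near: x;
    apply: nbhs_pinfty_gt; exact: num_real.
have xV : x^-1 @[x --> +oo%R] --> (0 : R).
  by apply/gtr0_cvgV0; [|exact: cvg_id]; near=> x; near: x;
    apply: nbhs_pinfty_gt; exact: num_real.
have -> : - (C * b) = c0 * (0 * 0) + C * (c1 * 0 - b * 1) by ring.
apply: (@cvg_trans _ ((c0 * (x^-1 * (ln x `^ eta)^-1) +
  C * (c1 * (ln x `^ eta)^-1 - b * (ln (x / a) `^ eta / ln x `^ eta))) @[x --> +oo%R])).
  apply: near_eq_cvg; near=> x.
  have x0 : x != 0
    by rewrite gt_eqF//; near: x; apply: nbhs_pinfty_gt; exact: num_real.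
  have l0 : ln x `^ eta != 0.
    rewrite gt_eqF//; apply: powR_gt0; apply: ln_gt0.
    by near: x; apply: nbhs_pinfty_gt; exact: num_real.
  by field; rewrite x0 l0.
apply: cvgD.
  by apply: cvgM; [exact: cvg_cst|exact: cvgM].
apply: cvgM; first exact: cvg_cst.
apply: cvgB; apply: cvgM => //; try exact: cvg_cst.
exact: cvgy_powR_ln_ratio.
Unshelve. all: end_near. Qed.

End log_asymptotics.

(** * Logarithmic tail bounds for the limit law *)

Section limit_tail.
Context {R : realType} {dM d d' : measure_display}.
Context {TM : measurableType dM} {PM : probability TM R} {M : {RV PM >-> R}}.
Context {T : measurableType d} {P : probability T R} {R_ M_ : nat -> {RV P >-> R}}.
Context {T' : measurableType d'} {P' : probability T' R} {Rlim : {RV P' >-> R}}.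
Context {beta eta q : R} {delta0 c C : R}.
Hypotheses (beta_gt0 : 0 < beta) (eta_gt0 : 0 < eta) (q_gt0 : 0 < q).
Hypotheses (delta0_01 : 0 < delta0 < 1) (c_gt0 : 0 < c) (C_gt0 : 0 < C).
Hypothesis M_01 : forall w, 0 <= M w <= 1.
Hypothesis M_copy : forall n, same_law P (M_ n.+1) PM M.
Hypothesis M_indep : forall n, independent_rv P (M_ n.+1) (R_ n).
Hypothesis R_rec : forall n,
  same_law P (R_ n.+1) P (fun w => q + M_ n.+1 w * R_ n w).
Hypothesis R_cvg : cvg_in_distribution R_ Rlim.
Hypothesis M_near_1 : forall delta, 0 < delta <= delta0 ->
  c * expR (- (beta * (- ln delta) `^ eta))
    <= fine (distribution PM M `]1 - delta, 1]%classic)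
    <= C * expR (- (beta * (- ln delta) `^ eta)).

(** The substitution delta = a / x, admissible once a / x <= delta0. *)
Let M_near_1_div a x : 0 < a -> 0 < x -> a / delta0 <= x ->
  c * expR (- (beta * ln (x / a) `^ eta))
    <= fine (distribution PM M `]1 - a / x, 1]%classic)
    <= C * expR (- (beta * ln (x / a) `^ eta)).
Proof.
move=> a0 x0 ax; have -> : ln (x / a) = - ln (a / x).
  by rewrite -lnV ?posrE ?divr_gt0// invf_div.
apply: M_near_1; rewrite divr_gt0//= ler_pdivrMr// mulrC -ler_pdivrMr//.
by case/andP: delta0_01.
Qed.

(* [a] makes k * (a / x) <= e / 4 for k <= (1 + 2 e) x / q, so that k >
   (1 + e) x / q factors suffice to exceed x. *)
Lemma ln_tail_ge (e : R) (a := q * e / (4 * (1 + 2 * e))) : 0 < e < 1 ->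
  \forall x \near +oo%R, 0 < tail P' Rlim x /\
    - ln 2 + x * ((1 + 2 * e) / q) * (ln c - beta * ln (x / a) `^ eta)
      <= ln (tail P' Rlim x).
Proof.
move=> /andP[e0 e1].
have a0 : 0 < a by rewrite !(mulr_gt0, invr_gt0, addr_gt0).
near=> x.
have x0 : 0 < x by near: x; apply: nbhs_pinfty_gt; exact: num_real.
have ax : a / delta0 <= x by near: x; apply: nbhs_pinfty_ge; exact: num_real.
(* Makes 1 <= e x / q, which absorbs the rounding up in [k]. *)
have qx : q / e <= x by near: x; apply: nbhs_pinfty_ge; exact: num_real.
have /andP[cg _] := M_near_1_div _ _ a0 x0 ax.
set g := fine _ in cg.
set E := c * _ in cg.
have E0 : 0 < E by rewrite mulr_gt0// expR_gt0.
have g0 : 0 < g by exact: lt_le_trans cg.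
have g1 : g <= 1.
  by rewrite -lee_fin fineK ?fin_num_measure// probability_le1.
pose k := (Num.truncn ((1 + e) * x / q)).+1.
have k_gt : (1 + e) * x / q < k%:R by exact: truncnS_gt.
have k_le : k%:R <= x * ((1 + 2 * e) / q).
  have -> : x * ((1 + 2 * e) / q) = (1 + e) * x / q + e * x / q by ring.
  rewrite -natr1; apply: lerD.
    by rewrite truncn_le !mulr_ge0 ?invr_ge0 ?ltW// addr_gt0.
  by rewrite ler_pdivlMr// mul1r mulrC -ler_pdivrMr.
have kd : k%:R * (a / x) <= e / 4.
  apply: (@le_trans _ _ (x * ((1 + 2 * e) / q) * (a / x))).
    by rewrite ler_wpM2r// divr_ge0// ltW.
  rewrite le_eqVlt; apply/orP; left; apply/eqP; rewrite /a; field.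
  by rewrite !gt_eqF// addr_gt0// mulr_gt0.
have kd1 : k%:R * (a / x) <= 1 by apply: (le_trans kd); lra.
have xk : x < k%:R * q * (1 - k%:R * (a / x)).
  (* (1 + e)(1 - e / 4) = 1 + e (3/4 - e / 4) > 1. *)
  apply: (@lt_le_trans _ _ ((1 + e) * x * (1 - e / 4))).
    have : 0 < e * x * (3 / 4 - e / 4) by rewrite !mulr_gt0//; lra.
    lra.
  apply: ler_pM; [by rewrite mulr_ge0 ?ltW// addr_gt0|lra| |lra].
  by rewrite -ler_pdivrMr// ltW.
have ad0 : 0 <= a / x by rewrite divr_ge0 ?ltW.
have := cvg_in_distribution_tail_ge R_cvg _ _ _ xk
  (tail_lower_bound _ q_gt0 M_01 M_copy M_indep R_rec _ _ ad0 kd1).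
rewrite -/g => gp.
have gk0 : 0 < g ^+ k / 2 by rewrite divr_gt0// exprn_gt0.
have p0 : 0 < tail P' Rlim x by exact: lt_le_trans gp.
split => //.
have : ln (g ^+ k / 2) <= ln (tail P' Rlim x) by rewrite ler_ln ?posrE.
apply: le_trans; rewrite [ln (g ^+ k / 2)]ln_div ?posrE ?exprn_gt0//.
rewrite lnXn// addrC lerD2r.
have -> : ln c - beta * ln (x / a) `^ eta = ln E.
  by rewrite /E [in RHS]lnM ?posrE ?expR_gt0// expRK.
(* Since E <= g <= 1, ln E <= 0, and replacing k by its upper bound only lowers k ln E. *)
rewrite -[ln g *+ k]mulr_natl; apply: (@le_trans _ _ (k%:R * ln E)).
  by rewrite ler_wnM2r// ln_le0// (le_trans cg).
by rewrite ler_wpM2l// ler_ln ?posrE.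
Unshelve. all: end_near. Qed.

(* [a] makes the threshold 2 q / (a / x) equal to e x; the bound is taken at
   (1 - e) x to leave room for the passage to the limit in distribution. *)
Lemma ln_tail_le (e : R) (a := 2 * q / e) : 0 < e < 2^-1 ->
  \forall x \near +oo%R, 0 < tail P' Rlim x ->
    ln (tail P' Rlim x)
      <= 0 + x * ((1 - 2 * e) / q) * (ln (4 * C) - beta * ln (x / a) `^ eta).
Proof.
move=> /andP[e0 e1].
have a0 : 0 < a by rewrite !mulr_gt0 ?invr_gt0.
near=> x => p0.
have x0 : 0 < x by near: x; apply: nbhs_pinfty_gt; exact: num_real.
have ax : a / delta0 <= x by near: x; apply: nbhs_pinfty_ge; exact: num_real.
have /andP[_ gC] := M_near_1_div _ _ a0 x0 ax.
set g := fine _ in gC.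
(* Chosen so that e^{-L} / 4 is exactly the upper bound on g. *)
pose L := beta * ln (x / a) `^ eta - ln (4 * C).
have EL : expR (- L) = 4 * (C * expR (- (beta * ln (x / a) `^ eta))).
  by rewrite /L opprB expRD lnK ?posrE ?mulr_gt0// mulrA.
have gL : g <= expR (- L) / 4 by rewrite EL mulrC mulKf.
have L4 : expR (- L) <= 4^-1.
  rewrite expRN lef_pV2 ?posrE ?expR_gt0// -[leLHS]lnK ?posrE// ler_expR.
  rewrite /L lerBrDr -ler_pdivrMl//.
  by near: x; exact: near_powR_ln_div_ge.
have d01 : 0 < a / x < 1.
  rewrite divr_gt0//= ltr_pdivrMr// mul1r (lt_le_trans _ ax)//.
  by rewrite ltr_pdivlMr ?gtr_pMr//; case/andP: delta0_01.
have xx : (1 - e) * x < x by rewrite gtr_pMl// gtrBl.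
have pb : tail P' Rlim x <= expR (- (L * ((1 - 2 * e) * x / q))).
  (* [tau] is removed only after the limit in n, since the rank given by [tail_upper_bound] depends
     on it. *)
  apply/ler_addgt0Pr => tau tau0; rewrite addrC.
  apply: (cvg_in_distribution_tail_le R_cvg _ _ _ xx).
  have := tail_upper_bound _ q_gt0 M_01 M_copy M_indep R_rec _ _ _
    ((1 - e) * x) d01 gL L4 tau0.
  have -> // : (1 - e) * x - 2 * q / (a / x) = (1 - 2 * e) * x.
  by rewrite /a; field; rewrite !gt_eqF.
rewrite -ler_expR lnK ?posrE//; apply: (le_trans pb).
by rewrite ler_expR /L le_eqVlt; apply/orP; left; apply/eqP; ring.
Unshelve. all: end_near. Qed.

End limit_tail.

(** * Squeeze of the normalised logarithm between the two bounds *)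

Theorem theorem5 (R : realType) (beta eta q : R)
    (beta_gt0 : 0 < beta) (eta_gt0 : 0 < eta) (q_gt0 : 0 < q)
    (nu : probability R R)
    (nu_F : has_distribution_function_F beta eta nu)
    (dM : measure_display) (TM : measurableType dM) (PM : probability TM R)
    (M : {RV PM >-> R})
    (M_01 : forall w : TM, 0 <= M w <= 1)
    (M_equiv : equivalent_at_1 (distribution PM M) nu)
    (d : measure_display) (T : measurableType d) (P : probability T R)
    (R_ M_ : nat -> {RV P >-> R})
    (M_copy : forall n : nat, same_law P (M_ n.+1) PM M)
    (M_indep : forall n : nat, independent_rv P (M_ n.+1) (R_ n))
    (R_rec : forall n : nat,
      same_law P (R_ n.+1) P (fun w => q + M_ n.+1 w * R_ n w))
    (d' : measure_display) (T' : measurableType d') (P' : probability T' R)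
    (Rlim : {RV P' >-> R})
    (R_cvg : cvg_in_distribution R_ Rlim) :
  (lne (P' [set w | (x <= Rlim w)%R]) / (x * (ln x) `^ eta)%:E)%E
    @[x --> +oo%R] --> (- (beta / q))%:E.
Proof.
have [delta0 [c [C [delta0_01 c0 C0 hM]]]] :=
  equivalent_at_1_bounds beta_gt0 eta_gt0 nu_F M_equiv.
pose p x := tail P' Rlim x.
have lo := ln_tail_ge q_gt0 delta0_01 c0 M_01 M_copy M_indep R_rec R_cvg hM.
have up := ln_tail_le beta_gt0 eta_gt0 q_gt0 delta0_01 C0 M_01 M_copy M_indep
  R_rec R_cvg hM.
have l0 : \forall x \near +oo%R, 0 < x * ln x `^ eta.
  near=> x; apply: mulr_gt0; [|apply: powR_gt0; apply: ln_gt0];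
    by near: x; apply: nbhs_pinfty_gt; exact: num_real.
(* Once p x > 0 and the denominator is nonzero, the extended-real quotient is the real one. *)
suff cvg_real : ln (p x) / (x * ln x `^ eta) @[x --> +oo%R] --> - (beta / q).
  apply: (@cvg_trans _ ((ln (p x) / (x * ln x `^ eta))%:E @[x --> +oo%R])).
    apply: near_eq_cvg; near=> x.
    have xl : 0 < x * ln x `^ eta by near: x.
    (* Any e in ]0, 1[ gives positivity; 1/2 is one choice. *)
    have px : 0 < p x by near: x; apply: filterS (lo 2^-1 _) => [x []|]//; lra.
    rewrite inver gt_eqF//.
    rewrite (_ : P' _ = (p x)%:E) ?lne_EFin ?EFinM//.
    rewrite tailE; congr (P' _).
    by apply/seteqP; split => w /=; rewrite in_itv/= andbT.
  by apply: cvg_EFin => //; exact: nearW.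
apply/cvgrPdist_le => r r0.
(* Half of r pays for passing from beta / q to (1 + 2 e) beta / q or (1 - 2 e) beta / q, the other
   half for the convergence of the two bounds; the cap 1/4 keeps e below 1/2, as [ln_tail_le]
   requires. *)
pose e := Num.min 4^-1 (r * q / (4 * beta)).
have e0 : 0 < e by rewrite /e lt_min invr_gt0 ltr0n /= !(divr_gt0, mulr_gt0).
have e1 : e <= 4^-1 by rewrite /e ge_min lexx.
have er : 2 * e * (beta / q) <= r / 2.
  apply: (@le_trans _ _ (2 * (r * q / (4 * beta)) * (beta / q))).
    rewrite ler_wpM2r//; first by rewrite ltW// divr_gt0.
    by rewrite ler_pM2l// /e ge_min lexx orbT.
  by rewrite le_eqVlt; apply/orP; left; apply/eqP; field; rewrite !gt_eqF.
have r2 : 0 < r / 2 by rewrite divr_gt0.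
have e01 : 0 < e < 1 by rewrite e0; lra.
have e02 : 0 < e < 2^-1 by rewrite e0; lra.
have a1 : 0 < q * e / (4 * (1 + 2 * e)).
  by rewrite !(mulr_gt0, invr_gt0, addr_gt0).
have a2 : 0 < 2 * q / e by rewrite !(mulr_gt0, invr_gt0).
have /cvgrPdist_le/(_ _ r2) lim_lo := cvgy_affine_powR_ln (- ln 2) (ln c)
  ((1 + 2 * e) / q) _ beta _ a1 eta_gt0.
have /cvgrPdist_le/(_ _ r2) lim_up := cvgy_affine_powR_ln 0 (ln (4 * C))
  ((1 - 2 * e) / q) _ beta _ a2 eta_gt0.
apply: filter_app l0; apply: filter_app lim_up; apply: filter_app lim_lo.
apply: filter_app (up _ e02); apply: filter_app (lo _ e01).
near=> x => -[px +] /(_ px) upx + + xl.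
rewrite -(ler_pM2r (_ : 0 < (x * ln x `^ eta)^-1)) ?invr_gt0//.
set u := (_ + _) / _ => lox.
move=> hu; set v := (_ + _) / _ => hv; move: upx.
rewrite -(ler_pM2r (_ : 0 < (x * ln x `^ eta)^-1)) ?invr_gt0// -/v => upx'.
move: hv hu; rewrite !ler_distl => /andP[hv1 hv2] /andP[hu1 hu2].
have E1 : (1 + 2 * e) / q * beta = beta / q + 2 * e * (beta / q) by ring.
have E2 : (1 - 2 * e) / q * beta = beta / q - 2 * e * (beta / q) by ring.
rewrite E1 in hu1 hu2; rewrite E2 in hv1 hv2.
rewrite -/(p x) in lox upx'.
apply/andP; split; lra.
Unshelve. all: end_near. Qed.
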